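(* Let $\hat\theta$ be the unique solution in $\Theta$ of the KKT conditions $$P_n\dot\rho_{\hat\theta}+\lambda\hat z=0,\quad \hat z_j={\rm sign}(\hat\theta_j)\text{ if }\hat\theta_j\ne0,\ j\notin\mathcal J;\quad \hat z_j=0\text{ if }j\in\mathcal J;\quad\|\hat z\|_\infty\le1 .$$ Consider some set $S\supset\mathcal J$ and suppose $\tilde\theta_S\in\Theta$ is the solution of the KKT conditions under the restriction that the coefficients are zero outside the set $S$: $$P_n(\dot\rho_{\tilde\theta_S})_S+\lambda\tilde z_S=0,$$ where $\tilde z_{j,S}={\rm sign}(\tilde\theta_{j,S})$ if $\tilde\theta_{j,S}\ne0$, $j\in S\setminus\mathcal J$; $\tilde z_{j,S}=0$ if $j\in\mathcal J$; and $\|\tilde z_S\|_\infty\le1$. Let $\lambda_w,\lambda_{\rm rem}\ge0$, $\mathcal T_w:=\{\|w\|_\infty\le\lambda_w\}$ and $\mathcal T_{\rm rem}:=\{\|{\rm rem}(\tilde\theta_S-\theta^0)\|_\infty\le\lambda_{\rm rem}\}$. Suppose $$\lambda|||\Gamma_{S^c}|||_{1,{\rm off}}+(\lambda_w+\lambda_{\rm rem})|||\Gamma_{S^c}|||_1+\|(\mathcal I_{S^c,S^c}-\Gamma_{S^c}^T\mathcal I_{S,S}\Gamma_{S^c})\theta^0_{S^c}\|_\infty\le\lambda-\lambda_w-\lambda_{\rm rem}.$$ Then on $\mathcal T_w\cap\mathcal T_{\rm rem}$ we have $\hat\theta_j=0$ for all $j\notin S$.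
   Context: $X_1,\dots,X_n$ are independent observations in a space $\mathcal X$; for $f:\mathcal X\to\mathbb R^d$, $P_nf:=\frac1n\sum_{i=1}^nf(X_i)$ and $Pf:=\mathbb E P_nf$. $\Theta\subset\mathbb R^p$ is convex, $\rho_\theta:\mathcal X\to\mathbb R$ ($\theta\in\Theta$) is a loss function with derivative $\dot\rho_\theta:=\partial\rho_\theta/\partial\theta$. $\mathcal J\subset\{1,\dots,p\}$ is a fixed set (indices of unpenalized parameters); the KKT conditions with tuning parameter $\lambda>0$ are those of minimizing $P_n\rho_\theta+\lambda\sum_{j\notin\mathcal J}|\theta_j|$ over $\Theta$. $\theta^0$ is the solution of $P\dot\rho_{\theta^0}=0$ (assumed to exist and be unique), and $\mathcal I:=\partial P\dot\rho_\theta/\partial\theta^T|_{\theta=\theta^0}$ is assumed to exist and be invertible; it is a symmetric positive definite $p\times p$ matrix. Define ${\rm rem}(\theta-\theta^0):=\mathcal I(\theta-\theta^0)-P_n(\dot\rho_\theta-\dot\rho_{\theta^0})$ and $w:=-P_n\dot\rho_{\theta^0}$. Subscripts $S$, $S^c$ denote sub-vectors/blocks; $\tilde\theta_S$ is regarded as a vector in $\mathbb R^p$ with zero entries outside $S$. $\Gamma_{S^c}:=\mathcal I_{S,S}^{-1}\mathcal I_{S,S^c}$ (rows indexed by $S$, columns by $S^c$). $|||\Gamma_{S^c}|||_1:=\max_{j\in S^c}\sum_{k\in S}|\Gamma_{S^c,k,j}|$ and $|||\Gamma_{S^c}|||_{1,{\rm off}}:=\max_{j\in S^c}\sum_{k\in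 S\setminus\mathcal J}|\Gamma_{S^c,k,j}|$. ''On an event'' means whenever the inequality defining it holds. *)

(* Defs.v *)
From HB Require Import structures.
From mathcomp Require Export all_boot all_order all_algebra.
From mathcomp Require Export all_classical all_reals all_analysis.

Set Implicit Arguments.
Unset Strict Implicit.
Unset Printing Implicit Defensive.

Import Order.TTheory GRing.Theory Num.Theory.
Export numFieldNormedType.Exports.
Local Open Scope classical_set_scope.
Local Open Scope ring_scope.

(* Vectors of R^d are columns ['cV[R]_d]; the canonical norm [`|v|] on them is
   the sup-norm, and it is [0] on the empty vector. *)

Section sampling.
Context {d d' : measure_display} {Omega : measurableType d}
  {calX : measurableType d'} {R : realType}.
Variable Pr : probability Omega R.

Definition mutually_independent (n : nat) (X : 'I_n -> {RV Pr >-> calX}) : Prop :=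
  forall (I : {set 'I_n}) (A : 'I_n -> set calX),
    (forall i, measurable (A i)) ->
    Pr (\bigcap_(i in [set` I]) (X i @^-1` A i)) =
    (\prod_(i in I) Pr (X i @^-1` A i))%E.

Definition emp_mean (n q : nat) (X : 'I_n -> {RV Pr >-> calX})
    (f : calX -> 'cV[R]_q) (w : Omega) : 'cV[R]_q :=
  n%:R^-1 *: \sum_(i < n) f (X i w).

Definition emp_mean_integrable (n q : nat) (X : 'I_n -> {RV Pr >-> calX})
    (f : calX -> 'cV[R]_q) : Prop :=
  forall j, Pr.-integrable setT (fun w => (emp_mean X f w j 0)%:E).

(* Meaningful under [emp_mean_integrable X f]. The [X i] need not be
   identically distributed. *)
Definition mean (n q : nat) (X : 'I_n -> {RV Pr >-> calX})
    (f : calX -> 'cV[R]_q) : 'cV[R]_q :=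
  \col_j fine ('E_Pr[(fun w => emp_mean X f w j 0)%R])%E.

End sampling.

Section derivatives.
Context {R : realType}.

(* Frechet derivative relative to [A]: increments are taken inside [A] only, so
   that [f] need not be defined outside the parameter space. At an interior
   point of [A] this is the usual derivative. *)
Definition has_jacobian_in (p q : nat) (A : set 'cV[R]_p)
    (f : 'cV[R]_p -> 'cV[R]_q) (D : 'M[R]_(q, p)) (a : 'cV[R]_p) : Prop :=
  (fun t => f t - f a - D *m (t - a))
    =o_ (within A (nbhs a)) (fun t => t - a).

Definition has_gradient_in (p : nat) (A : set 'cV[R]_p)
    (f : 'cV[R]_p -> R) (g : 'cV[R]_p) (a : 'cV[R]_p) : Prop :=
  has_jacobian_in A (fun t => (f t)%:M : 'cV[R]_1) g^T a.

End derivatives.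

Section blocks.
Context {R : realType} {p : nat}.

Definition subvec (S : {set 'I_p}) (v : 'cV[R]_p) : 'cV[R]_#|S| :=
  rowsub (@enum_val _ (mem S)) v.

Definition block (S T : {set 'I_p}) (M : 'M[R]_p) : 'M[R]_(#|S|, #|T|) :=
  mxsub (@enum_val _ (mem S)) (@enum_val _ (mem T)) M.

Definition Gam (Inf : 'M[R]_p) (S : {set 'I_p}) : 'M[R]_(#|S|, #|~: S|) :=
  invmx (block S S Inf) *m block S (~: S) Inf.

Definition norm1 (m q : nat) (G : 'M[R]_(m, q)) : R :=
  \big[Num.max/0]_(j < q) \sum_(k < m) `|G k j|.

(* The rows of [G] are indexed by [S]; those in [J] are left out of the sum. *)
Definition norm1_off (S J : {set 'I_p}) (q : nat) (G : 'M[R]_(#|S|, q)) : R :=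
  \big[Num.max/0]_(j < q)
    \sum_(k < #|S| | @enum_val _ (mem S) k \notin J) `|G k j|.

Definition posdef (M : 'M[R]_p) : Prop :=
  forall v : 'cV[R]_p, v != 0 -> 0 < (v^T *m M *m v) 0 0.

End blocks.

Section kkt.
Context {R : realType} {p : nat}.
Variables (Theta : set 'cV[R]_p) (J : {set 'I_p}) (lambda : R).

(* [grad theta] plays the role of P_n (rho-dot_theta) for a given sample. *)
Definition kkt (grad : 'cV[R]_p -> 'cV[R]_p) (theta : 'cV[R]_p) : Prop :=
  Theta theta /\
  exists z : 'cV[R]_p,
    [/\ grad theta + lambda *: z = 0,
        forall j, theta j 0 != 0 -> j \notin J -> z j 0 = Num.sg (theta j 0),
        forall j, j \in J -> z j 0 = 0 &
        `|z| <= 1].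

(* The coefficient vector lives in R^p and vanishes off [S]; the dual vector
   [z] is indexed by [S] only. *)
Definition restricted_kkt (S : {set 'I_p}) (grad : 'cV[R]_p -> 'cV[R]_p)
    (theta : 'cV[R]_p) : Prop :=
  [/\ Theta theta,
      forall j, j \notin S -> theta j 0 = 0 &
      exists z : 'cV[R]_#|S|,
        [/\ subvec S (grad theta) + lambda *: z = 0,
            forall k : 'I_#|S|, subvec S theta k 0 != 0 ->
              enum_val k \notin J -> z k 0 = Num.sg (subvec S theta k 0),
            forall k : 'I_#|S|, enum_val k \in J -> z k 0 = 0 &
            `|z| <= 1]].

End kkt.

(* Main.v *)
(* Primal-dual witness argument.  By definition of [rem], the gradient at the
   restricted solution is Inf (thetatilde - theta0) - (w + rem).  Its S-part is
   - lambda z; eliminating it from the other part with the Schur complement,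
   and using that thetatilde vanishes off S, gives
     grad_(~: S) = Gamma^T ((w + rem)_S - lambda z)
                   - (Schur complement) theta0_(~: S) - (w + rem)_(~: S).
   The irrepresentability condition bounds the right-hand side by lambda, so
   thetatilde satisfies the full KKT conditions and equals thetahat by
   uniqueness. *)
Require Import Defs.
From mathcomp Require Import lra.

Set Implicit Arguments.
Unset Strict Implicit.
Unset Printing Implicit Defensive.

Import Order.TTheory GRing.Theory Num.Theory.
Local Open Scope classical_set_scope.
Local Open Scope ring_scope.

Section SupNorm.
Context {R : realType}.

(** The sign of [c] matters when the matrix is empty: its norm is 0 and the entrywise bound is
    vacuous. *)
Lemma mx_norm_leP (m n : nat) (M : 'M[R]_(m, n)) (c : R) : 0 <= c ->
  reflect (forall i j, `|M i j| <= c) (`|M| <= c).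
Proof.
move=> c0; have -> : `|M| = mx_norm M by [].
rewrite mx_normrE.
apply: (iffP (bigmax_leP _ _ _ _)) => [[_ Mc] i j|Mc]; first exact: (Mc (i, j)).
by split => // -[i j] _; apply: Mc.
Qed.

Lemma mx_norm_ge_coord (m n : nat) (M : 'M[R]_(m, n)) i j : `|M i j| <= `|M|.
Proof. by move: i j; apply/mx_norm_leP. Qed.

(** Hölder's inequality for each column of [G] against [u]. Rows where [u] is known to vanish drop
    out of the sum, so one lemma serves both [norm1] and [norm1_off]. *)
Lemma mx_norm_trmul_le (m n : nat) (G : 'M[R]_(m, n)) (P : pred 'I_m)
    (u : 'cV[R]_m) : (forall k, ~~ P k -> u k 0 = 0) ->
  `|G^T *m u| <= (\big[Num.max/0]_(j < n) \sum_(k < m | P k) `|G k j|) * `|u|.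
Proof.
move=> u0; apply/mx_norm_leP => [|j k].
  by apply: mulr_ge0 => //; apply: bigmax_ge_id.
rewrite ord1 mxE (bigID P)/= [X in _ + X]big1 ?addr0; last first.
  by move=> i /u0 ->; rewrite mulr0.
apply: (le_trans (ler_norm_sum _ _ _)).
apply: le_trans (_ : _ <= (\sum_(k < m | P k) `|G k j|) * `|u|) _.
  rewrite mulr_suml; apply: ler_sum => i _.
  by rewrite mxE normrM ler_wpM2l// mx_norm_ge_coord.
by rewrite ler_wpM2r//; exact: (le_bigmax _ (fun j => \sum_(k | P k) `|G k j|)).
Qed.

End SupNorm.

Section Blocks.
Context {R : realType} {p : nat}.
Implicit Types (S T : {set 'I_p}) (M : 'M[R]_p) (v : 'cV[R]_p).

Lemma subvec_mul S T M v :
  subvec S (M *m v) =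
  block S T M *m subvec T v + block S (~: T) M *m subvec (~: T) v.
Proof.
apply/colP => k; rewrite !mxE (bigID (mem T))/=; congr (_ + _).
  by rewrite big_enum_val; apply: eq_bigr => i _; rewrite !mxE.
rewrite (eq_bigl (mem (~: T))) => [|j]; last by rewrite /= inE.
by rewrite big_enum_val; apply: eq_bigr => i _; rewrite !mxE.
Qed.

Lemma trmx_block S T M : (block S T M)^T = block T S M^T.
Proof. by apply/matrixP => i j; rewrite !mxE. Qed.

Lemma block_rowsubE S M :
  block S S M = rowsub (@enum_val _ (mem S)) 1%:M *m M
                *m (rowsub (@enum_val _ (mem S)) 1%:M)^T.
Proof.
rewrite trmx_mxsub trmx1 mul_rowsub_mx mul1mx mulmx_colsub mulmx1.
by rewrite -mxsub_comp.
Qed.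

(** If [x] is in the left kernel of the block, the quadratic form of [M] vanishes at [E^T *m x^T],
    which is [x] padded with zeros outside [S]. Positive definiteness forces this vector to be zero,
    and [E] recovers [x] from it. *)
Lemma posdef_block_unitmx S M : posdef M -> block S S M \in unitmx.
Proof.
move=> Mpos; rewrite -row_free_unit; apply: inj_row_free => x xM0.
pose E : 'M[R]_(#|S|, p) := rowsub (@enum_val _ (mem S)) 1%:M.
have EE : E *m E^T = 1%:M.
  apply/matrixP => i j; rewrite /E trmx_mxsub trmx1 mul_rowsub_mx mul1mx.
  by rewrite !mxE (inj_eq enum_val_inj).
suff /eqP/(congr1 (mulmx E)) : E^T *m x^T == 0.
  by rewrite mulmxA EE mul1mx mulmx0 => /(congr1 trmx); rewrite trmxK trmx0.
apply: contraT => /Mpos.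
rewrite trmx_mul !trmxK mulmxA -(mulmxA x) -(mulmxA x) -block_rowsubE.
by rewrite xM0 mul0mx mxE ltxx.
Qed.

(** Block Gaussian elimination: by symmetry the transpose of [Gam M S] times the [S] block is the
    lower left block, so the [S] part of [v] enters only through [M *m v], and the Schur complement
    is left acting on the rest of [v]. *)
Lemma subvec_mul_setC S M v : block S S M \in unitmx -> M^T = M ->
  subvec (~: S) (M *m v) =
  (Gam M S)^T *m subvec S (M *m v)
  + (block (~: S) (~: S) M - (Gam M S)^T *m block S S M *m Gam M S)
    *m subvec (~: S) v.
Proof.
move=> uM symM.
have GM : (Gam M S)^T *m block S S M = block (~: S) S M.
  by rewrite -[RHS]trmxK trmx_block symM -[RHS]trmxK trmxK -[block S S M]trmxK
     -trmx_mul trmx_block symM mulKVmx.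
have GB : (Gam M S)^T *m block S (~: S) M =
          (Gam M S)^T *m block S S M *m Gam M S.
  by rewrite -!mulmxA mulKVmx.
move: (Gam M S) GM GB => G GM GB.
rewrite !(subvec_mul _ S) mulmxDr mulmxBl !mulmxA GB GM.
by rewrite -addrA [X in _ = _ + X]addrC subrK.
Qed.

Lemma subvecB S : {morph @subvec R p S : u v / u - v}.
Proof. by move=> u v; apply/colP => k; rewrite !mxE. Qed.

Lemma subvec_norm_le S v : `|subvec S v| <= `|v|.
Proof. by apply/mx_norm_leP => // i j; rewrite mxE mx_norm_ge_coord. Qed.

End Blocks.

Lemma emp_meanB (d d' : measure_display) (Omega : measurableType d)
    (calX : measurableType d') (R : realType) (Pr : probability Omega R)
    (n q : nat) (X : 'I_n -> {RV Pr >-> calX}) (f g : calX -> 'cV[R]_q) om :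
  emp_mean X (fun x => f x - g x) om = emp_mean X f om - emp_mean X g om.
Proof. by rewrite /emp_mean sumrB scalerBr. Qed.

(* Off [S] the dual vector is forced to be [- grad theta / lambda], so only its
   bound is left to check. *)
Lemma restricted_kkt_kkt (R : realType) (p : nat) (Theta : set 'cV[R]_p)
    (J S : {set 'I_p}) (lambda : R) (grad : 'cV[R]_p -> 'cV[R]_p)
    (theta : 'cV[R]_p) : 0 < lambda -> J \subset S ->
  restricted_kkt Theta J lambda S grad theta ->
  `|subvec (~: S) (grad theta)| <= lambda ->
  kkt Theta J lambda grad theta.
Proof.
move=> l0 JS [thT th0 [z [zE zsg zJ z1]]] gle; split=> //.
have l_neq0 : lambda != 0 by rewrite gt_eqF.
pose zz : 'cV[R]_p := - (lambda^-1 *: grad theta).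
(* On [S] the restricted stationarity equation says that [z] is given by the same formula, so [zz]
   extends [z] and inherits its sign, zero and norm conditions there. *)
have zzS (k : 'I_#|S|) : zz (enum_val k) 0 = z k 0.
  move/eqP: zE; rewrite addrC addr_eq0 => /eqP zE.
  have /colP/(_ k) := congr1 (fun v => lambda^-1 *: v) zE.
  by rewrite /zz scalerA mulVf// scale1r !mxE mulrN => ->.
have inS j : j \in S -> exists k : 'I_#|S|, j = enum_val k.
  by move=> jS; exists (enum_rank_in jS j); rewrite enum_rankK_in.
exists zz; split.
- by rewrite /zz scalerN scalerA divff// scale1r subrr.
- move=> j thj jJ; have [jS|/th0 th0j] := boolP (j \in S); last first.
    by rewrite th0j eqxx in thj.
  have [k jk] := inS _ jS; move: thj jJ; rewrite jk zzS => thj jJ.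
  by rewrite zsg// mxE.
- move=> j jJ; have [k jk] := inS _ (fintype.subsetP JS _ jJ).
  by move: jJ; rewrite jk zzS; exact: zJ.
- apply/mx_norm_leP => // j k; rewrite ord1 {k}.
  have [/inS[k ->]|jS] := boolP (j \in S).
    by rewrite zzS; exact: le_trans (mx_norm_ge_coord _ _ _) z1.
  have jSC : j \in ~: S by rewrite inE.
  rewrite /zz !mxE normrN normrM gtr0_norm ?invr_gt0//.
  rewrite mulrC ler_pdivrMr// mul1r.
  have := le_trans (mx_norm_ge_coord _ (enum_rank_in jSC j) 0) gle.
  by rewrite mxE enum_rankK_in.
Qed.

Theorem theorem4p2 (R : realType)
  (d d' : measure_display) (Omega : measurableType d)
  (calX : measurableType d') (Pr : probability Omega R)
  (n : nat) (n_gt0 : (0 < n)%N)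
  (X : 'I_n -> {RV Pr >-> calX}) (X_indep : mutually_independent X)
  (p : nat) (Theta : set 'cV[R]_p) (Theta_convex : convex_set Theta)
  (rho : 'cV[R]_p -> calX -> R) (rhodot : 'cV[R]_p -> calX -> 'cV[R]_p)
  (rhodotE : forall theta, Theta theta -> forall x,
     has_gradient_in Theta (fun t => rho t x) (rhodot theta x) theta)
  (rhodot_int : forall theta, Theta theta ->
     emp_mean_integrable X (rhodot theta))
  (theta0 : 'cV[R]_p) (theta0_in : Theta theta0)
  (theta0E : mean X (rhodot theta0) = 0)
  (theta0_uniq : forall theta, Theta theta -> mean X (rhodot theta) = 0 ->
     theta = theta0)
  (Inf : 'M[R]_p)
  (InfE : has_jacobian_in Theta (fun t => mean X (rhodot t)) Inf theta0)
  (Inf_unit : Inf \in unitmx) (Inf_sym : Inf^T = Inf) (Inf_posdef : posdef Inf)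
  (J : {set 'I_p}) (lambda : R) (lambda_gt0 : 0 < lambda)
  (thetahat : Omega -> 'cV[R]_p)
  (thetahat_kkt : forall om,
     kkt Theta J lambda (fun t => emp_mean X (rhodot t) om) (thetahat om))
  (thetahat_uniq : forall om theta,
     kkt Theta J lambda (fun t => emp_mean X (rhodot t) om) theta ->
     theta = thetahat om)
  (S : {set 'I_p}) (JS : J \subset S)
  (thetatilde : Omega -> 'cV[R]_p)
  (thetatilde_kkt : forall om,
     restricted_kkt Theta J lambda S (fun t => emp_mean X (rhodot t) om)
       (thetatilde om))
  (lambda_w lambda_rem : R)
  (lambda_w_ge0 : 0 <= lambda_w) (lambda_rem_ge0 : 0 <= lambda_rem) :
  let w om := - emp_mean X (rhodot theta0) om in
  let rem theta om := Inf *m (theta - theta0)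
    - emp_mean X (fun x => rhodot theta x - rhodot theta0 x) om in
  let T_w := [set om | `|w om| <= lambda_w] in
  let T_rem := [set om | `|rem (thetatilde om) om| <= lambda_rem] in
  let Gamma := Gam Inf S in
  lambda * norm1_off J Gamma + (lambda_w + lambda_rem) * norm1 Gamma
    + `|(block (~: S) (~: S) Inf - Gamma^T *m block S S Inf *m Gamma)
          *m subvec (~: S) theta0|
    <= lambda - lambda_w - lambda_rem ->
  forall om, (T_w `&` T_rem) om ->
    forall j, j \notin S -> thetahat om j 0 = 0.
Proof.
move=> w rem T_w T_rem Gamma irrep om [Tw Trem] j jS.
pose grad t := emp_mean X (rhodot t) om.
set theta := thetatilde om in Trem *.
have tkkt := thetatilde_kkt om; rewrite -/theta in tkkt.
suff /thetahat_uniq <- : kkt Theta J lambda grad theta.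
  by case: tkkt => _ ->.
apply: restricted_kkt_kkt (tkkt) _ => //.
have {tkkt} [_ th0 [z [zE _ zJ z1]]] := tkkt.
have uS := posdef_block_unitmx S Inf_posdef.
set u := w om + rem theta om.
have u_le : `|u| <= lambda_w + lambda_rem.
  by rewrite (le_trans (ler_normD _ _))// lerD.
have gradE : grad theta = Inf *m (theta - theta0) - u.
  rewrite /u /rem emp_meanB /w /grad opprD opprK opprB.
  by rewrite addrCA [_ + (_ - _ - _)]addrC subrK addrC subrK.
set C := block (~: S) (~: S) Inf - Gamma^T *m block S S Inf *m Gamma in irrep.
have InfdS : subvec S (Inf *m (theta - theta0)) = subvec S u - lambda *: z.
  move/eqP: zE; rewrite -/(grad theta) gradE subvecB addr_eq0 subr_eq.
  by move/eqP ->; rewrite addrC.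
have dSC : subvec (~: S) (theta - theta0) = - subvec (~: S) theta0.
  apply/colP => k; rewrite !mxE th0 ?sub0r//.
  by have := enum_valP k; rewrite inE.
rewrite [X in subvec _ X]gradE subvecB subvec_mul_setC// -/Gamma -/C InfdS dSC.
rewrite mulmxN mulmxBr -scalemxAr.
(* No entry of the noise term [u] is known to vanish, so all rows of [Gamma] count. *)
have Gu : `|Gamma^T *m subvec S u| <= (lambda_w + lambda_rem) * norm1 Gamma.
  apply: le_trans (mx_norm_trmul_le (P := predT) _ _) _ => //.
  rewrite mulrC ler_wpM2r ?bigmax_ge_id//.
  exact: le_trans (subvec_norm_le _ _) u_le.
(* The dual vector is zero at unpenalized indices; hence the rows in [J] are left out and
   [norm1_off] suffices. *)
have Gz : `|lambda *: (Gamma^T *m z)| <= lambda * norm1_off J Gamma.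
  rewrite normrZ gtr0_norm// ler_wpM2l ?(ltW lambda_gt0)//.
  apply: le_trans (mx_norm_trmul_le (P := fun k => enum_val k \notin J) _ _) _.
    by move=> k; rewrite negbK; exact: zJ.
  by rewrite ler_piMr// bigmax_ge_id.
have uSC : `|subvec (~: S) u| <= lambda_w + lambda_rem.
  exact: le_trans (subvec_norm_le _ _) u_le.
(* Three triangle inequalities split the gradient into its four terms. The bound [uSC] uses up
   exactly the slack [lambda_w + lambda_rem] on the right of [irrep], and the other three terms
   match its left side. *)
apply: le_trans (ler_normB _ _) _.
apply: le_trans (lerD (ler_normB _ _) (lexx _)) _.
apply: le_trans (lerD (lerD (ler_normB _ _) (lexx _)) (lexx _)) _.
lra.
Qed.
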